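(* Let $\mathfrak{B}$ be a bornology with a compact base on a Tychonoff space $X$. Then $st(C_{\mathfrak{B}}(X))=t(C_{\mathfrak{B}}(X))$.
   Context: A bornology $\mathfrak{B}$ on $X$ is a family of subsets of $X$ that is closed under taking subsets and finite unions and covers $X$; by standing convention $X\notin\mathfrak{B}$. A base of $\mathfrak{B}$ is a subfamily $\mathfrak{B}_0\subseteq\mathfrak{B}$ such that every $B\in\mathfrak{B}$ is contained in some $B_0\in\mathfrak{B}_0$; it is compact if its members are compact. $C_{\mathfrak{B}}(X)$ is the set $C(X)$ of continuous real-valued functions on $X$ with the topology of uniform convergence on $\mathfrak{B}$, in which the sets $\{g\in C(X):|f(x)-g(x)|<\varepsilon\ \forall x\in B\}$ ($B\in\mathfrak{B}$, $\varepsilon>0$) form a neighbourhood base at $f$. For a space $Y$, the tightness $t(Y)$ is the smallest infinite cardinal $\mathfrak{m}$ such that whenever $C\subseteq Y$ and $y\in\overline{C}$ there is $D\subseteq C$ with $y\in\overline{D}$ and $|D|\le\mathfrak{m}$. A family $\mathcal{C}$ of nonempty subsets of $Y$ is a $\pi$-network at $y\in Y$ if each neighbourhood of $y$ contains some member of $\mathcal{C}$. The supertightness $st(y,Y)$ of $y$ is the smallest cardinal $\mathfrak{m}$ such that each $\pi$-network $\mathcal{C}$ at $y$ consisting of finite subsets of $Y$ has a subcollection $\mathcal{D}$ with $|\mathcal{D}|\le\mathfrak{m}$ that is a $\pi$-network at $y$; and $st(Y)=\omega\cdot\sup\{st(y,Y):y\in Y\}$. *)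

(* Defs.v *)
From HB Require Import structures.
From mathcomp Require Import all_boot all_order all_algebra.
From mathcomp Require Import all_classical all_reals all_analysis.
Import Order.TTheory GRing.Theory Num.Theory numFieldNormedType.Exports.

Set Implicit Arguments.
Unset Strict Implicit.
Unset Printing Implicit Defensive.

Local Open Scope classical_set_scope.
Local Open Scope ring_scope.
Local Open Scope card_scope.

(* T_{3 1/2}.  The library states complete regularity with uniform separators;
   [tychonoff_spaceP] gives the form with real-valued functions. *)
Definition tychonoff_space (X : topologicalType) : Prop :=
  hausdorff_space X /\ completely_regular_space X.

Lemma tychonoff_spaceP (R : realType) (X : topologicalType) :
  tychonoff_space X <->
  hausdorff_space X /\
  forall (a : X) (F : set X), closed F -> ~ F a ->
    exists f : X -> R, [/\ continuous f, range f `<=` `[0, 1],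
      f a = 0 & forall x, F x -> f x = 1].
Proof.
split=> -[hX crX]; split=> // a F cF aF.
  have /(@uniform_separatorP _ R)[f [cf rf f0 f1]] := crX _ _ cF aF.
  exists f; split=> //.
    by have := f0 (f a); apply; exists a.
  by move=> x Fx; have := f1 (f x); apply; exists x.
have [f [cf rf f0 f1]] := crX _ _ cF aF.
apply/(@uniform_separatorP _ R); exists f; split=> //.
  by move=> _ [x -> <-].
by move=> _ [x Fx <-]; exact: f1.
Qed.

(* [bornology_set0] is the empty finite union; [bornology_proper] is the
   convention that the whole space is not bounded. *)
Record bornology (X : Type) (B : set_system X) : Prop := Bornology {
  bornology_set0 : B set0;
  bornology_sub : forall A A' : set X, A' `<=` A -> B A -> B A';
  bornology_setU : forall A A' : set X, B A -> B A' -> B (A `|` A');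
  bornology_cover : \bigcup_(A in B) A = [set: X];
  bornology_proper : ~ B [set: X] }.

Definition bornology_base (X : Type) (B B0 : set_system X) : Prop :=
  B0 `<=` B /\ forall A, B A -> exists2 A0, B0 A0 & A `<=` A0.

Definition has_compact_base (X : topologicalType) (B : set_system X) : Prop :=
  exists B0 : set_system X,
    bornology_base B B0 /\ forall A, B0 A -> compact A.

(* The topology is the one induced by the library's topology of uniform
   convergence on the members of [B]; [CB_nbhsP] gives the basic
   neighbourhoods. *)
Definition CB (R : realType) (X : topologicalType) (B : set_system X) : Type :=
  continuousType X R.

Section CB_topology.
Context (R : realType) (X : topologicalType) (B : set_system X).

HB.instance Definition _ := Topological.copy (CB R B)
  (initial_topology
    ((fun f : continuousType X R => (f : X -> R)) :
       continuousType X R -> {family B, X -> R})).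

Lemma CB_nbhsP (f : CB R B) (P : set (CB R B)) : bornology B ->
  nbhs f P <->
  exists (A : set X) (e : R), [/\ B A, 0 < e &
    [set g : CB R B | forall x, A x ->
       `|(f : continuousType X R) x - (g : continuousType X R) x| < e] `<=` P].
Proof.
move=> bB; split.
  pose S : set_system (continuousType X R) := fun P => exists A (e : R),
    [/\ B A, 0 < e & [set g : continuousType X R | forall x, A x ->
       `|(f : continuousType X R) x - g x| < e] `<=` P].
  have SF : Filter S.
    split.
    - by exists set0, 1; split; [exact: bornology_set0 bB|exact: ltr01|].
    - move=> P1 P2 [A1 [e1 [B1 e10 s1]]] [A2 [e2 [B2 e20 s2]]].
      exists (A1 `|` A2), (Num.min e1 e2); split.
      + exact: (bornology_setU bB).
      + by rewrite lt_min e10.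
      + move=> g gA; split.
          apply: s1 => x Ax; have := gA x (or_introl Ax).
          by rewrite lt_min => /andP[].
        apply: s2 => x Ax; have := gA x (or_intror Ax).
        by rewrite lt_min => /andP[].
    - move=> P1 P2 P12 [A [e [BA e0 s]]]; exists A, e; split=> //.
      exact: subset_trans P12.
  pose F : set_system (X -> R) := fun Q => S [set g : continuousType X R | Q g].
  have FF : Filter F.
    split; first exact: (@filterT _ S).
      by move=> P1 P2; exact: (@filterI _ S).
    by move=> P1 P2 P12; apply: (@filterS _ S) => g; exact: P12.
  have Ff : {family B, F --> ((f : continuousType X R) : X -> R)}.
    apply/fam_cvgP => A BA W /uniform_nbhs[E [entE EW]].
    move: entE; rewrite -entourage_ballE => -[e /= e0 eE].
    exists A, e; split=> // g gA; apply: EW => y Ay; apply: eE => /=.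
    exact: gA.
  move=> [U [[V oV <-] fV] UP].
  have : F V by apply: Ff; apply: open_nbhs_nbhs.
  by apply: (@filterS _ S).
move=> [A [e [BA e0 AP]]].
apply: (filterS AP).
have := @fam_nbhs X R B A [set xy | ball xy.1 e xy.2]
  (f : continuousType X R) (@entourage_ball R R (PosNum e0)) BA.
exact: (@initial_continuous _ _ ((fun f : continuousType X R => (f : X -> R)) :
       continuousType X R -> {family B, X -> R}) f).
Qed.

End CB_topology.

(* A cardinal is represented by a type [K] having that cardinality, i.e. types
   are taken up to the library's equipotence [#=] of their full sets. *)
Definition is_least_cardinal (P : Type -> Prop) (K : Type) : Prop :=
  P K /\ forall K' : Type, P K' -> [set: K] #<= [set: K'].

Lemma is_least_cardinal_uniq (P : Type -> Prop) (K K' : Type) :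
  is_least_cardinal P K -> is_least_cardinal P K' -> [set: K] #= [set: K'].
Proof. by move=> [PK minK] [PK' minK']; rewrite card_eq_le minK ?minK'. Qed.

Definition is_cardinal_sup (F : Type -> Prop) (S : Type) : Prop :=
  is_least_cardinal
    (fun M => forall K : Type, F K -> [set: K] #<= [set: M]) S.

Definition is_tightness (Y : topologicalType) : Type -> Prop :=
  is_least_cardinal (fun M => infinite_set [set: M] /\
    forall (C : set Y) (y : Y), closure C y ->
      exists D : set Y, [/\ D `<=` C, closure D y & D #<= [set: M]]).

Definition pi_network (Y : topologicalType) (y : Y) (C : set_system Y) : Prop :=
  (forall A, C A -> A !=set0) /\
  forall U, nbhs y U -> exists2 A, C A & A `<=` U.

Definition is_supertightness_at (Y : topologicalType) (y : Y) : Type -> Prop :=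
  is_least_cardinal (fun M =>
    forall C : set_system Y, pi_network y C -> (forall A, C A -> finite_set A) ->
      exists D : set_system Y,
        [/\ D `<=` C, D #<= [set: M] & pi_network y D]).

(* [nat * S] is the cardinal product of omega and the supremum. *)
Definition is_supertightness (Y : topologicalType) (K : Type) : Prop :=
  exists2 S : Type,
    is_cardinal_sup (fun M => exists y : Y, is_supertightness_at y M) S &
    [set: K] #= [set: nat * S].

(* Main.v *)
Require Import Defs.
From mathcomp Require Import all_boot all_order all_algebra.
From mathcomp Require Import all_classical all_reals all_analysis.
Import Order.TTheory GRing.Theory Num.Theory numFieldNormedType.Exports.

(** Bounding tightness by supertightness works in every space: when [y] lies in
the closure of [C], the singletons of points of [C] form a pi-network at [y]
consisting of finite sets, and a small subnetwork is a small subset of [C]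
accumulating at [y] ([tightness_le_of_supertightness]).

Conversely, let the tightness of the function space be at most an infinite
cardinal [M].  Then every open cover of the bornology (each bounded set lies in
a single member) has a subcover of size at most [M] ([bornology_subcover]): the
functions equal to 1 off some member of the cover accumulate at 0, because
compact sets can be separated from closed ones ([compact_separator]) and the
base is compact; [M] of these functions still accumulate at 0, and the members
of the cover attached to them again form a cover, since a function which is less
than 1 on a bounded set forces that set into its member.  Now let [C] be a
pi-network at [f] consisting of finite sets.  For each [n] the sets
[V n F], where all functions of [F] are closer than 1/(n+1) to [f], are open for
[F] in [C], and they cover the bornology because [C] is a pi-network.  Choosing
a subcover of size [M] for each [n] and taking the union over [n] gives a
subnetwork of size at most [M] ([supertightness_le_of_tightness]).

As cardinals are represented by types, what remains is to see that the
invariants exist and that [nat * M] is no larger than [M] when [M] is infinite.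
The first fact holds since any family of types has one that embeds into all the
others ([injective_into_all]); the second follows by decomposing [M] into
disjoint sequences ([infinite_card_le_nat_prod]). *)

Set Implicit Arguments.
Unset Strict Implicit.
Unset Printing Implicit Defensive.

Local Open Scope classical_set_scope.
Local Open Scope ring_scope.
Local Open Scope card_scope.

(** * Cardinals of types *)

Lemma card_le_setTP (T U : Type) :
  [set: T] #<= [set: U] <-> exists f : T -> U, injective f.
Proof.
split=> [|[f f_inj]]; last first.
  suff [g] : $|{injfun [set: T] >-> [set: U]}| by exact: inj_card_le g.
  by apply/injfunPex; exists f => // x y _ _; exact: f_inj.
elim/Ppointed: U => U.
  rewrite [X in _ #<= X]emptyE => /card_le0P T0.
  have nT (x : T) : False by have : [set: T] x by []; rewrite T0.
  by exists (fun x => False_rect U (nT x)) => x; case: (nT x).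
move=> /pcard_injP[f f_inj]; exists f => x y; apply: f_inj; exact: in_setT.
Qed.

(** Well-foundedness of cardinals, by Zorn's lemma on subsets [Z] of the product
of the family whose projections are all injective: if no projection of a maximal
[Z] were onto, then a point avoiding every projection could be added to it.
When the projection to [K i] is onto, [K i] is in bijection with [Z], which
embeds into each factor. *)
Lemma injective_into_all (I : Type) (i0 : I) (K : I -> Type) :
  exists i, forall j, exists f : K i -> K j, injective f.
Proof.
pose P (Z : set (forall i, K i)) :=
  forall i z z', Z z -> Z z' -> z i = z' i -> z = z'.
have [Z [PZ Zmax]] : exists Z, P Z /\ forall Z', Z `<` Z' -> ~ P Z'.
  apply: Zorn_bigcup => F FP Ftot i z z' [A FA Az] [A' FA' A'z'].
  have [AA'|A'A] := Ftot _ _ FA FA'.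
  - exact: (FP _ FA' i) (AA' _ Az) A'z'.
  - exact: (FP _ FA i) Az (A'A _ A'z').
suff [i /choice[s sP]] : exists i, forall k : K i, exists z, Z z /\ z i = k.
  exists i => j; exists (fun k => s k j) => k k'.
  have [[Zk skk] [Zk' sk'k']] := (sP k, sP k').
  by move=> /(PZ _ _ _ Zk Zk') sE; rewrite -skk sE.
apply: contrapT => noti.
have /all_sig[w wP] : forall i, {k : K i | forall z, Z z -> z i <> k}.
  move=> i; apply: cid; apply: contrapT => notk; apply: noti; exists i => k.
  apply: contrapT => notz; apply: notk; exists k => z Zz zik.
  by apply: notz; exists z.
apply: (Zmax (Z `|` [set w])).
  by split=> [z|/(_ w (or_intror erefl)) /(wP i0)]; [left|].
move=> i z z' [Zz|->] [Zz'|->] //; first exact: (PZ i).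
- by move/(wP i _ Zz).
- by move/esym/(wP i _ Zz').
Qed.

Lemma card_le_total (T U : Type) :
  [set: T] #<= [set: U] \/ [set: U] #<= [set: T].
Proof.
have [[] inj] := injective_into_all true (fun b : bool => if b then T else U).
- by left; apply/card_le_setTP; exact: (inj false).
- by right; apply/card_le_setTP; exact: (inj true).
Qed.

(** Cardinals up to that of [K0] are those of subsets of [K0], so the family of
all types satisfying [P] reduces to one indexed by a type. *)
Lemma least_cardinal_exists (P : Type -> Prop) (K0 : Type) :
  (forall M M' : Type, [set: M] #= [set: M'] -> P M -> P M') -> P K0 ->
  exists K, is_least_cardinal P K.
Proof.
move=> P_eq PK0.
have PT : P [set: K0] by apply: P_eq PK0; exact: card_setT_sym.
have [[A PA] /= A_min] := injective_into_all
  (exist (fun A : set K0 => P A) setT PT) (fun A => set_type (sval A)).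
exists A; split=> // K' PK'.
have [|K0K'] := card_le_total K' K0; last first.
  apply: card_le_trans K0K'; rewrite (card_le_eql (card_setT A)).
  exact: card_leT.
move=> /card_le_setTP[f f_inj].
have rK' : range f #= [set: K'] by apply: inj_card_eq => x y _ _; exact: f_inj.
have rT : [set: range f] #= [set: K'] := card_eq_trans (card_setT _) rK'.
have Pr : P (range f) by apply: P_eq PK'; rewrite card_eq_sym.
rewrite -(card_le_eqr rT).
apply/card_le_setTP; exact: (A_min (exist _ _ Pr)).
Qed.

(** A maximal set [S] of injective sequences in [K] with disjoint ranges leaves
out only finitely many points.  Hence [K] embeds into [(nat + nat) * S]: the left
summand is for points on a sequence of [S], and the right one numbers the
remaining points.  Then [nat * K] embeds into [(nat * (nat + nat)) * S], where
the first factor is countable, so it can be absorbed in the index along the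
sequence, which leads back to [K]. *)
Lemma infinite_card_le_nat_prod (K : Type) : infinite_set [set: K] ->
  [set: nat * K] #<= [set: K].
Proof.
elim/Ppointed: K => K.
  by rewrite emptyE => /(_ (finite_set0 _)).
move=> infK.
pose P (S : set (nat -> K)) := forall s t i j,
  S s -> S t -> s i = t j -> s = t /\ i = j.
have [S [PS Smax]] : exists S, P S /\ forall S', S `<` S' -> ~ P S'.
  apply: Zorn_bigcup => F FP Ftot s t i j [A FA As] [A' FA' A't].
  have [AA'|A'A] := Ftot _ _ FA FA'.
  - exact: (FP _ FA') (AA' _ As) A't.
  - exact: (FP _ FA) As (A'A _ A't).
pose D := [set x | exists s i, S s /\ s i = x].
have finD : finite_set (~` D).
  (* An infinite complement would contain one more sequence. *)
  apply: contrapT => /infiniteP/pcard_leP/injfunPex[s sD s_inj].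
  apply: (Smax (S `|` [set s])).
    split=> [t|/(_ s (or_intror erefl)) Ss]; first by left.
    by apply: (sD 0%N I); exists s, 0%N.
  move=> t t' i j [St|->] [St'|->]; first exact: PS.
  - by move=> tisj; case: (sD j I); exists t, i.
  - by move=> sit'j; case: (sD i I); exists t', j.
  - by move=> /s_inj ->; rewrite ?inE.
have [s0 Ss0] : S !=set0.
  have [x [s [i [Ss _]]]] : D !=set0.
    exact/infinite_setN0/cofinite_set_infinite.
  by exists s.
have /countable_injP[e e_inj] := finite_set_countable finD.
have /choice[c cP] : forall x, exists c : (nat + nat) * (nat -> K),
    S c.2 /\ match c.1 with
             | inl i => c.2 i = x
             | inr j => ~ D x /\ e x = j
             end.
  move=> x; have [[s [i [Ss six]]]|nDx] := pselect (D x).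
    by exists (inl i, s).
  by exists (inr (e x), s0).
have c_inj : injective c.
  move=> x y cxy; have := (cP x, cP y); rewrite -cxy.
  case: (c x) => -[i|j] s /= [[_ xE] [_ yE]]; first by rewrite -xE -yE.
  by apply: e_inj; rewrite ?inE; [exact: xE.1|exact: yE.1|rewrite xE.2 yE.2].
apply/card_le_setTP; exists (fun nx => (c nx.2).2 (pickle (nx.1, (c nx.2).1))).
move=> [n x] [m y] /= /(PS _ _ _ _ (cP x).1 (cP y).1)[cxy].
move=> /(pcan_inj pickleK)[-> cxy1]; congr (_, _).
by apply: c_inj; rewrite [c x]surjective_pairing cxy cxy1 -surjective_pairing.
Qed.

Lemma bigcup_nat_card_le (T M : Type) (F : nat -> set T) :
  infinite_set [set: M] -> (forall n, F n #<= [set: M]) ->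
  \bigcup_n F n #<= [set: M].
Proof.
elim/Ppointed: M => M.
  by rewrite emptyE => /(_ (finite_set0 _)).
move=> infM FM; apply: card_le_trans (infinite_card_le_nat_prod infM).
have /choice[f f_inj] : forall n, exists f : T -> M, {in F n &, injective f}.
  by move=> n; exact/pcard_injP.
have /choice[k kP] : forall x, exists k, (\bigcup_n F n) x -> F k x.
  move=> x; have [[n _ Fnx]|] := pselect ((\bigcup_n F n) x); first by exists n.
  by move=> nx; exists 0%N => /nx.
apply/pcard_injP; exists (fun x => (k x, f (k x) x)) => x y.
rewrite !inE => /kP Fx /kP Fy [kxy]; rewrite kxy in Fx *.
by apply: f_inj; rewrite inE.
Qed.

(** * Separating compact sets from closed sets *)

(** The continuous functions equal to 1 off [U] are closed under products, and
the zero set of a product contains those of its factors.  They are thus directed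
by their zero sets and generate a filter [F]; complete regularity says that each
point of [A] has a neighbourhood on which [F]-eventually all functions vanish,
and compactness, as near covering, makes this uniform over [A]. *)
Lemma compact_separator (R : realType) (X : topologicalType) (A U : set X) :
  completely_regular_space X -> compact A -> open U -> A `<=` U ->
  exists g : X -> R, [/\ continuous g, forall x, A x -> g x = 0 &
    forall x, ~ U x -> g x = 1].
Proof.
move=> crX /compact_near_coveringP cA oU AU.
pose S (g : X -> R) := continuous g /\ forall x, ~ U x -> g x = 1.
pose F : set_system (X -> R) := fun Q => exists2 g0, S g0 &
  forall g, S g -> (forall x, g0 x = 0 -> g x = 0) -> Q g.
have FF : Filter F.
  split=> [|Q1 Q2 [g1 [cg1 U1] Q1g] [g2 [cg2 U2] Q2g]|Q1 Q2 Q12 [g0 Sg0 Q1g]].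
  - by exists (cst 1) => //; split=> // x; exact: cvg_cst.
  - exists (fun x => g1 x * g2 x).
      split=> [x|x nUx]; first by apply: continuousM; [exact: cg1|exact: cg2].
      by rewrite U1// U2// mulr1.
    move=> g Sg g12; split; [apply: Q1g|apply: Q2g] => // x gx; apply: g12.
      by rewrite gx mul0r.
    by rewrite gx mulr0.
  - by exists g0 => // g Sg /Q1g-/(_ Sg)/Q12.
have [a Aa|g [cg Ug] gA] := cA _ F (fun g x => g x = 0) FF; last first.
  by exists g; split=> // x Ax; exact: gA.
have /(@uniform_separatorP _ R)[f [cf _ f0 f1]] :=
  crX a (~` U) (open_closedC oU) (fun nUa => nUa (AU _ Aa)).
(* Truncation turns a zero at [a] into a zero on a neighbourhood of [a]. *)
pose h x : R := Num.max 0 (2 * f x - 1).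
exists ([set x | f x < 2^-1],
  [set g : X -> R | forall x, h x = 0 -> g x = 0]) => /=.
  split.
    apply: (cf a [set r | r < 2^-1]); apply: open_nbhs_nbhs; split.
      exact: open_lt.
    by rewrite /= (f0 (f a)) ?invr_gt0//; exists a.
  exists h => //; split=> [x|x nUx].
    apply: (@continuous_max R X (cst 0) (fun x => 2 * f x - 1)); first exact: cvg_cst.
    apply: continuousB; last exact: cvg_cst.
    by apply: continuousM; [exact: cvg_cst|exact: cf].
  by rewrite /h (f1 (f x)) ?mulr1 ?addrK; [exact/max_idPr|exists x].
move=> [x g] [/= fx hg]; apply: hg; apply/max_idPl.
by rewrite subr_le0 -ler_pdivlMl// mulr1 ltW.
Qed.

(** * Tightness and supertightness of an arbitrary space *)

(** The property of which [is_tightness] takes the least cardinal. *)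
Definition has_tightness_le (Y : topologicalType) (M : Type) : Prop :=
  infinite_set [set: M] /\
  forall (C : set Y) (y : Y), closure C y ->
    exists D : set Y, [/\ D `<=` C, closure D y & D #<= [set: M]].

(** The property of which [is_supertightness_at] takes the least cardinal. *)
Definition has_supertightness_at_le (Y : topologicalType) (y : Y) (M : Type) :
    Prop :=
  forall C : set_system Y, pi_network y C -> (forall A, C A -> finite_set A) ->
    exists D : set_system Y, [/\ D `<=` C, D #<= [set: M] & pi_network y D].

Lemma has_tightness_leS (Y : topologicalType) (M M' : Type) :
  [set: M] #<= [set: M'] -> has_tightness_le Y M -> has_tightness_le Y M'.
Proof.
move=> MM' [/infiniteP infM tM]; split.
  by apply/infiniteP; exact: card_le_trans MM'.
move=> C y /tM[D [DC yD DM]]; exists D; split=> //; exact: card_le_trans MM'.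
Qed.

Lemma has_supertightness_at_leS (Y : topologicalType) (y : Y) (M M' : Type) :
  [set: M] #<= [set: M'] ->
  has_supertightness_at_le y M -> has_supertightness_at_le y M'.
Proof.
move=> MM' sM C yC finC; have [D [DC DM yD]] := sM C yC finC.
by exists D; split=> //; exact: card_le_trans MM'.
Qed.

Lemma tightness_exists (Y : topologicalType) : exists K, is_tightness Y K.
Proof.
apply: (@least_cardinal_exists (has_tightness_le Y) (Y + nat)%type).
  by move=> M M' MM'; apply: has_tightness_leS; rewrite (card_le_eql MM').
have injl : [set: Y] #<= [set: Y + nat].
  by apply/card_le_setTP; exists inl => ? ? [].
split; first by apply/infiniteP/card_le_setTP; exists inr => ? ? [].
move=> C y yC; exists C; split=> //.
by apply: card_le_trans injl; exact: card_leT.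
Qed.

Lemma supertightness_at_exists (Y : topologicalType) (y : Y) :
  exists K, is_supertightness_at y K.
Proof.
apply: (@least_cardinal_exists (has_supertightness_at_le y) (set Y)).
  by move=> M M' MM'; apply: has_supertightness_at_leS; rewrite (card_le_eql MM').
by move=> C yC finC; exists C; split=> //; exact: card_leT.
Qed.

Lemma pi_network_singletons (Y : topologicalType) (y : Y) (C : set Y) :
  closure C y -> pi_network y [set [set c] | c in C].
Proof.
move=> yC; split=> [_ [c _ <-]|U /yC[c [Cc Uc]]]; first by exists c.
by exists [set c]; [exists c|move=> _ ->].
Qed.

Lemma tightness_le_of_supertightness (Y : topologicalType) (M : Type) :
  infinite_set [set: M] -> (forall y : Y, has_supertightness_at_le y M) ->
  has_tightness_le Y M.
Proof.
move=> infM sM; split=> // C y yC.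
have [_ [c _ <-] //|F [FC FM [_ yF]]] := sM y _ (pi_network_singletons yC).
exists (C `&` [set c | F [set c]]); split=> [c []//|U /yF[S FS SU]|].
  by have [c Cc cS] := FC _ FS; exists c; subst S; split=> //; exact: SU.
apply: card_le_trans FM.
have singl_inj : set_inj (C `&` [set c | F [set c]]) (@set1 Y).
  by move=> c d _ _ /seteqP[/(_ c erefl)].
rewrite -(card_le_eql (inj_card_eq singl_inj)).
by apply: subset_card_le => _ [c [_ Fc] <-].
Qed.

(** The supertightness is never 0, so multiplying it by [nat] gives an infinite
cardinal. *)
Lemma supertightness_at_nonempty (Y : topologicalType) (y : Y) (M : Type) :
  has_supertightness_at_le y M -> [set: M] !=set0.
Proof.
have yy : pi_network y [set [set y]].
  split=> [_ ->|U /nbhs_singleton Uy]; first by exists y.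
  by exists [set y] => // _ ->.
move=> /(_ _ yy)[_ -> //|D [_ DM [_ /(_ setT filterT)[A DA _]]]].
by apply/set0P; apply: contraPN DA => /eqP M0; move: DM; rewrite M0 => /card_le0P ->.
Qed.

(** * Spaces of continuous functions *)

Section CB_supertightness.
Context (R : realType) (X : topologicalType) (B : set_system X).
Hypotheses (crX : completely_regular_space X) (bornB : bornology B)
  (compB : has_compact_base B).

Local Notation ev g := (g : continuousType X R).

(** Tightness is applied at the zero function [z], to the set [C] of functions
equal to 1 off some member of the cover. *)
Lemma bornology_subcover (M : Type) (I : Type) (J : set I) (U : I -> set X) :
  has_tightness_le (CB R B) M -> (forall i, J i -> open (U i)) ->
  (forall A, B A -> exists2 i, J i & A `<=` U i) ->
  exists J' : set I, [/\ J' `<=` J, J' #<= [set: M] &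
    forall A, B A -> exists2 i, J' i & A `<=` U i].
Proof.
move=> [_ tM] oU covU.
have [i0 Ji0 _] := covU _ (bornology_set0 bornB).
pose C : set (CB R B) := [set g | exists2 i, J i & forall x, ~ U i x -> ev g x = 1].
pose z : CB R B := cst 0 : continuousType X R.
have zC : closure C z.
  move=> W /(CB_nbhsP _ _ bornB)[A [e [BA e0 AW]]].
  have [B0 [[B0B baseB0] compB0]] := compB.
  have [A0 B0A0 AA0] := baseB0 _ BA.
  have [i Ji A0U] := covU _ (B0B _ B0A0).
  have [g [cg g0 g1]] :=
    compact_separator R crX (compB0 _ B0A0) (oU _ Ji) A0U.
  exists (mkcts cg : continuousType X R); split; first by exists i.
  by apply: AW => x /AA0/g0 gx; rewrite /= /mkcts gx subrr normr0.
have [D [DC zD DM]] := tM _ _ zC.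
have /choice[k kP] : forall g : CB R B, exists i, C g ->
    J i /\ forall x, ~ U i x -> ev g x = 1.
  move=> g; have [[i Ji gU]|] := pselect (C g); first by exists i.
  by exists i0.
exists (k @` D); split.
- by move=> _ [g /DC/kP[Jk _] <-].
- by apply: card_le_trans DM; exact: card_image_le.
move=> A BA.
have [g [Dg gA]] : D `&` [set g : CB R B | forall x, A x ->
    `|ev z x - ev g x| < 1] !=set0.
  by apply: zD; apply/(CB_nbhsP _ _ bornB); exists A, 1; split; rewrite ?ltr01.
have [Jk gU] := kP _ (DC _ Dg).
exists (k g); first by exists g.
move=> x Ax; apply: contrapT => /gU gx1.
by have := gA _ Ax; rewrite gx1 /= sub0r normrN normr1 ltxx.
Qed.

(** The members of the subcovers of the open covers [V n] are recorded by the
sets [F] defining them, which is why [bornology_subcover] is about indexed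
families. *)
Lemma supertightness_le_of_tightness (M : Type) (f : CB R B) :
  has_tightness_le (CB R B) M -> has_supertightness_at_le f M.
Proof.
move=> tM C [C_neq0 fC] finC.
pose V (n : nat) (F : set (CB R B)) : set X :=
  \bigcap_(g in F) [set x | `|ev f x - ev g x| < n.+1%:R^-1].
have /choice[D DP] n : exists D : set_system (CB R B),
    [/\ D `<=` C, D #<= [set: M] &
      forall A, B A -> exists2 F, D F & A `<=` V n F].
  apply: bornology_subcover => // [F CF|A BA].
    rewrite /V; have /finite_fsetP[S ->] := finC _ CF.
    rewrite openE => x Vx; apply: filter_bigI => g gS.
    have oW : open [set x | `|ev f x - ev g x| < n.+1%:R^-1].
      apply: (@open_comp _ _ (fun x => `|ev f x - ev g x|) [set r | r < n.+1%:R^-1]).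
        by move=> y _; apply: cvg_norm; apply: cvgB; exact: cts_fun.
      exact: open_lt.
    by apply: open_nbhs_nbhs; split=> //; exact: Vx.
  have [|F CF FA] := fC [set g : CB R B | forall x, A x ->
      `|ev f x - ev g x| < n.+1%:R^-1].
    by apply/(CB_nbhsP _ _ bornB); exists A, n.+1%:R^-1; split; rewrite ?invr_gt0.
  by exists F => // x Ax g Fg; exact: FA.
exists (\bigcup_n D n); split=> [F [n _ DF]||].
- by have [DC _ _] := DP n; exact: DC.
- by apply: bigcup_nat_card_le => [|n]; [case: tM|case: (DP n)].
split=> [F [n _ DF]|W /(CB_nbhsP _ _ bornB)[A [e [BA e0 AW]]]].
  by have [DC _ _] := DP n; exact/C_neq0/DC.
have [n] := ltr_add_invr e0; rewrite add0r => ne.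
have [_ _ /(_ _ BA)[F DF AF]] := DP n.
exists F; first by exists n.
by move=> g Fg; apply: AW => x Ax; apply: lt_trans ne; exact: AF.
Qed.

End CB_supertightness.

Theorem theorem5p14 (R : realType) (X : topologicalType) (B : set_system X)
    (tychX : tychonoff_space X) (bornB : bornology B)
    (compB : has_compact_base B) :
  exists K : Type,
    is_supertightness (CB R B) K /\ is_tightness (CB R B) K.
Proof.
have [_ crX] := tychX.
have [K tK] := tightness_exists (CB R B); exists K; split=> //.
have [tKle Kmin] := tK; have [infK _] := tKle.
pose isst M := exists y : CB R B, is_supertightness_at y M.
pose bound M := forall L, isst L -> [set: L] #<= [set: M].
have boundK : bound K.
  move=> L [f [_ minL]]; apply: minL.
  exact: supertightness_le_of_tightness tKle.
have [S [boundS Smin]] : exists S, is_least_cardinal bound S.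
  apply: least_cardinal_exists boundK => M M' MM' bM L /bM LM.
  by apply: card_le_trans LM _; rewrite (card_le_eql MM').
exists S; first by [].
have stS (f : CB R B) : has_supertightness_at_le f S.
  have [L stL] := supertightness_at_exists f.
  apply: has_supertightness_at_leS (boundS L _) stL.1; by exists f.
have [s0 _] : [set: S] !=set0.
  exact: supertightness_at_nonempty (stS (cst 0 : continuousType X R)).
rewrite card_eq_le; apply/andP; split.
  apply: Kmin; apply: tightness_le_of_supertightness.
    by apply/infiniteP/card_le_setTP; exists (fun n => (n, s0)) => m n [].
  move=> f; apply: has_supertightness_at_leS (stS f).
  by apply/card_le_setTP; exists (fun s => (0%N, s)) => s t [].
apply: card_le_trans (infinite_card_le_nat_prod infK).
have /card_le_setTP[i i_inj] := Smin _ boundK.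
by apply/card_le_setTP; exists (fun ns => (ns.1, i ns.2)) => -[n s] [m t] [-> /i_inj ->].
Qed.
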